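(* Let $(p_n)_{n\ge1}$ be the regular paperfolding sequence over $\{-1,1\}$, and let $(q_n)_{n\ge 1}$ be the sequence over $\{0,1\}$ with $p_n=(-1)^{q_n}$. Define $d'_1=1$ and $d'_n=|q_n-q_{n-1}|$ for $n\ge 2$, and let $b_n$ be the length of the $n$'th run of the sequence $(d'_n)_{n\ge1}$. Let $(a_n)_{n\ge1}$ be Cloitre's sequence, i.e., the unique sequence over $\{1,2\}$ with $a_1=1$ such that, for every $n\ge1$, the sum of the terms in the $n$'th run of the sequence equals $2a_n$. Then $a_n=b_n$ for all $n\ge 1$.
   Context: A run in a sequence is a maximal block of consecutive identical values; runs are numbered $1,2,3,\ldots$ from left to right. For a finite sequence $x$ over $\{-1,1\}$, $-x$ denotes the sequence obtained by changing the sign of every element, and $x^R$ denotes the reversal of $x$. The regular paperfolding sequence $(p_n)_{n\ge 1}$ is the unique infinite sequence having all of the finite sequences $P_k$ as prefixes, where $P_0$ is the empty sequence and $P_{k+1}$ is the concatenation $P_k \; 1 \; (-P_k^R)$ for $k\ge0$; it begins $1,1,-1,1,1,-1,-1,\ldots$. Cloitre's sequence begins $1,1,2,1,1,1,1,2,1,1,2,1,1,2,2,\ldots$. All sequences here are indexed from $1$. *)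

(* Defs.v *)
From mathcomp Require Import all_boot all_order all_algebra.
From mathcomp Require Import boolp classical_sets.

Set Implicit Arguments.
Unset Strict Implicit.
Unset Printing Implicit Defensive.

Import GRing.Theory.

(* A sequence indexed from 1 is a function on nat whose value at 0 is ignored. *)

(* s_i, ..., s_(i+l-1) is a nonempty constant block that cannot be extended to
   the right. *)
Definition block (T : Type) (s : nat -> T) (i l : nat) : Prop :=
  [/\ (0 < l)%N,
      forall j, (i <= j < i + l)%N -> s j = s i
    & s (i + l)%N <> s i].

(* nth_run s n i l: the n'th run of s starts at index i and has finite length l.
   Blocks are maximal on the left too, since each one starts at index 1 or
   right after the previous run. *)
Inductive nth_run (T : Type) (s : nat -> T) : nat -> nat -> nat -> Prop :=
| nth_run1 l : block s 1 l -> nth_run s 1 1 l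
| nth_runS n i l l' :
    nth_run s n i l -> block s (i + l) l' -> nth_run s n.+1 (i + l) l'.

(* The value is 0, never the length of a run, if s has no finite n'th run. *)
Definition run_length (T : Type) (s : nat -> T) (n : nat) : nat :=
  xget 0%N [set l | exists i, nth_run s n i l]%classic.

Lemma block_inj (T : Type) (s : nat -> T) i l l' :
  block s i l -> block s i l' -> l = l'.
Proof.
move=> [l0 H N] [l0' H' N']; case: (ltngtP l l') => // h.
  by case: N; apply: H'; rewrite leq_addr ltn_add2l.
by case: N'; apply: H; rewrite leq_addr ltn_add2l.
Qed.

Lemma nth_run_inj (T : Type) (s : nat -> T) n i l i' l' :
  nth_run s n i l -> nth_run s n i' l' -> i = i' /\ l = l'.
Proof.
move=> H; elim: H i' l' => {n i l} [l bl|n i l m Hr IH bl] i' l' H'.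
  inversion H'; subst; first by split=> //; apply: (block_inj bl).
  by match goal with h : nth_run _ 0 _ _ |- _ => inversion h end.
inversion H'; subst; first by inversion Hr.
match goal with h : nth_run _ n _ _ |- _ => case: (IH _ _ h) => ? ? end.
by subst; split=> //; apply: (block_inj bl).
Qed.

Lemma run_lengthE (T : Type) (s : nat -> T) n i l :
  nth_run s n i l -> run_length s n = l.
Proof.
move=> H; rewrite /run_length.
by case: xgetP => [y _ [j /= Hj]|/(_ l) []]; [case: (nth_run_inj Hj H)|exists i].
Qed.

Fixpoint pf_word (k : nat) : seq int :=
  if k is k'.+1 then
    pf_word k' ++ 1%R :: [seq (- x)%R | x <- rev (pf_word k')]
  else [::].

Definition is_prefix (T : Type) (w : seq T) (s : nat -> T) : Prop :=
  [seq s i | i <- iota 1 (size w)] = w.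

Definition paperfolding (p : nat -> int) : Prop :=
  forall k, is_prefix (pf_word k) p.

Lemma is_prefixP (T : Type) (x0 : T) w s :
  is_prefix w s <-> forall i, (i < size w)%N -> s i.+1 = nth x0 w i.
Proof.
split=> [E i lti|H].
  by rewrite -[in RHS]E (nth_map 0%N) ?size_iota // nth_iota.
apply: (@eq_from_nth _ x0) => [|i]; first by rewrite size_map size_iota.
rewrite size_map size_iota => lti.
by rewrite (nth_map 0%N) ?size_iota // nth_iota // add1n H.
Qed.

Lemma exists_limit (T : Type) (x0 : T) (w : nat -> seq T) :
  (forall k, (k < size (w k.+1))%N) ->
  (forall k, exists v, w k.+1 = w k ++ v) ->
  exists s : nat -> T, forall k, is_prefix (w k) s.
Proof.
move=> szw wS; exists (fun i => nth x0 (w i) i.-1) => k.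
have pre m j i : (i < size (w m))%N -> nth x0 (w (m + j)%N) i = nth x0 (w m) i
                 /\ (i < size (w (m + j)))%N.
  move=> lti; elim: j => [|j [IH1 IH2]]; first by rewrite addn0.
  have [v E] := wS (m + j)%N; rewrite addnS E nth_cat size_cat IH2 IH1.
  by split=> //; apply: ltn_addr.
apply/(is_prefixP x0) => i lti /=; case: (leqP k i.+1) => h.
  by have [] := pre _ (i.+1 - k)%N _ lti; rewrite subnKC.
by have [] := pre _ (k - i.+1)%N _ (szw i); rewrite subnKC // ltnW.
Qed.

Lemma paperfolding_exists : exists p, paperfolding p.
Proof.
apply: (@exists_limit int 0%R) => k; last by exists (1%R :: [seq (- x)%R | x <- rev (pf_word k)]).
elim: k => // k IH; rewrite [pf_word _]/= -/(pf_word k.+1) size_cat.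
by apply: leq_ltn_trans IH _; rewrite -[ltnLHS]addn0 ltn_add2l.
Qed.

Definition dprime (q : nat -> nat) (n : nat) : nat :=
  if n == 1%N then 1%N else absz ((q n)%:Z - (q n.-1)%:Z)%R.

Definition cloitre (a : nat -> nat) : Prop :=
  [/\ forall n, (0 < n)%N -> a n = 1%N \/ a n = 2%N,
      a 1%N = 1%N
    & forall n, (0 < n)%N ->
        exists i l, nth_run a n i l /\ (\sum_(i <= j < i + l) a j = 2 * a n)%N].

(* The i'th run (i counted from 0) of Cloitre's sequence when its (i+1)'st term
   is x; iterating cl_expand on 1 yields the sequence. *)
Definition cl_block (i x : nat) : seq nat :=
  if odd i then nseq x 2 else nseq (2 * x) 1%N.

Definition cl_expand (w : seq nat) : seq nat :=
  flatten (mkseq (fun i => cl_block i (nth 0%N w i)) (size w)).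

Lemma cl_expand_rcons w x :
  cl_expand (rcons w x) = cl_expand w ++ cl_block (size w) x.
Proof.
rewrite /cl_expand size_rcons /mkseq -addn1 iotaD map_cat flatten_cat /= cats0.
rewrite nth_rcons ltnn eqxx; congr (flatten _ ++ _).
by apply/eq_in_map => i; rewrite mem_iota => /= lti; rewrite nth_rcons lti.
Qed.

Lemma cl_expand_cat w v : exists u, cl_expand (w ++ v) = cl_expand w ++ u.
Proof.
elim/last_ind: v => [|v x [u E]]; first by exists [::]; rewrite !cats0.
by rewrite -rcons_cat cl_expand_rcons E -catA; eexists.
Qed.

Lemma cl_expand12 w :
  all (fun x => (x == 1) || (x == 2))%N (cl_expand w).
Proof.
elim/last_ind: w => // w x IH; rewrite cl_expand_rcons all_cat IH /cl_block /=.
by case: ifP => _; rewrite all_nseq orbT.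
Qed.

Lemma size_cl_expand w : all (fun x => 0 < x)%N w -> (0 < size w)%N ->
  (size w < size (cl_expand w))%N.
Proof.
elim/last_ind: w => // w x IH; rewrite all_rcons => /andP[x0 w0] _.
rewrite cl_expand_rcons size_cat size_rcons.
case: (posnP (size w)) => [/size0nil -> /=|/(IH w0) {}IH].
  by rewrite add0n /cl_block size_nseq (leq_mul (leqnn 2) x0).
have h : (0 < size (cl_block (size w) x))%N.
  by rewrite /cl_block; case: ifP => _; rewrite size_nseq ?muln_gt0.
by rewrite -[(size w).+2]addn1 leq_add.
Qed.

Lemma cloitre_exists : exists a, cloitre a.
Proof.
pose W k := iter k cl_expand [:: 1%N].
have W12 k : all (fun x => (x == 1) || (x == 2))%N (W k).
  by case: k => // k; apply: cl_expand12.
have Wpos k : all (fun x => 0 < x)%N (W k).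
  by apply: sub_all (W12 k) => x /orP[] /eqP ->.
have szW k : (k < size (W k))%N.
  elim: k => // k IH; apply: (leq_ltn_trans IH).
  by apply: size_cl_expand => //; apply: leq_ltn_trans IH.
have WS k : exists v, W k.+1 = W k ++ v.
  elim: k => [|k [v E]]; first by exists [:: 1%N].
  by have := cl_expand_cat (W k) v; rewrite -E.
have [a aW] := exists_limit 0%N (fun k => ltnW (szW k.+1)) WS.
have aE k i : (i < size (W k))%N -> a i.+1 = nth 0%N (W k) i.
  exact: (is_prefixP 0%N _ _).1 (aW k) i.
have a12 n : (0 < n)%N -> a n = 1%N \/ a n = 2%N.
  case: n => // n _; rewrite (aE n n (szW n)).
  by have /orP[/eqP|/eqP] := all_nthP 0%N (W12 n) n (szW n); [left|right].
have a0 n : (0 < n)%N -> (0 < a n)%N by case/a12 => ->.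
pose A n := [seq a i | i <- iota 1 n].
have szA n : size (A n) = n by rewrite size_map size_iota.
have AS n : A n.+1 = rcons (A n) (a n.+1).
  by rewrite /A -[n.+1]addn1 iotaD map_cat cats1 add1n addn1.
have FA n : is_prefix (cl_expand (A n)) a.
  apply/(is_prefixP 0%N) => i lti.
  have [v E] : exists v, W n = A n ++ v.
    exists (drop n (W n)); rewrite -[LHS](cat_take_drop n); congr (_ ++ _).
    rewrite -(aW n) -map_take take_iota; congr map; congr iota.
    by rewrite (minn_idPl (ltnW (szW n))).
  have [u E'] := cl_expand_cat (A n) v.
  have E2 : W n.+1 = cl_expand (A n) ++ u by rewrite -E' -E.
  by rewrite (aE n.+1) E2 ?nth_cat ?lti // size_cat ltn_addr.
pose val n := if odd n then 2%N else 1%N.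
pose len n := size (cl_block n (a n.+1)).
pose S n := size (cl_expand (A n)).
have SS n : S n.+1 = (S n + len n)%N.
  by rewrite /S AS cl_expand_rcons size_cat szA.
have blk n x : cl_block n x = nseq (size (cl_block n x)) (val n).
  by rewrite /cl_block /val; case: ifP; rewrite size_nseq.
have len0 n : (0 < len n)%N.
  rewrite /len /cl_block; have := a0 n.+1 isT.
  by case: ifP => _; rewrite size_nseq ?muln_gt0.
have aval n j : (S n < j <= S n + len n)%N -> a j = val n.
  case: j => // j /andP[h1 h2].
  rewrite ((is_prefixP 0%N _ _).1 (FA n.+1)) -/(S n.+1) ?SS //.
  rewrite AS cl_expand_rcons szA nth_cat -/(S n) ltnNge -ltnS h1 /= blk nth_nseq.
  by rewrite -/(len n) ltn_subLR // h2.
have bl n : block a (S n).+1 (len n).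
  split=> [|j /andP[h1 h2]|]; first exact: len0.
    rewrite (@aval n) ?h1 /=; last by move: h2; rewrite addSn ltnS.
    by rewrite (@aval n) // leqnn /= -addn1 leq_add2l.
  rewrite addSn -SS (@aval n.+1); last by rewrite leqnn /= -addn1 leq_add2l.
  rewrite (@aval n); last by rewrite leqnn /= -addn1 leq_add2l.
  by rewrite /val /=; case: odd.
have run n : nth_run a n.+1 (S n).+1 (len n).
  elim: n => [|n IH]; first exact: nth_run1 (bl 0%N).
  by rewrite SS -addSn; apply: nth_runS IH _; rewrite addSn -SS.
exists a; split=> //; first by rewrite (aE 0%N).
case=> // n _; exists (S n).+1, (len n); split=> //.
rewrite (eq_big_nat _ _ (F2 := fun=> val n)); last first.
  by move=> j /andP[h1 h2]; apply: aval; rewrite h1 -ltnS -addSn.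
rewrite sum_nat_const_nat addKn /len /cl_block /val.
by case: ifP => _; rewrite size_nseq ?muln1 // mulnC.
Qed.

(* Main.v *)
Require Import Defs.
From mathcomp Require Import all_boot all_order all_algebra.
From mathcomp Require Import zify.

Set Implicit Arguments.
Unset Strict Implicit.
Unset Printing Implicit Defensive.

Import GRing.Theory.

(** Write d for the sequence [dprime q] and b for its sequence of run lengths.
    The paperfolding sequence satisfies q_(2k) = q_k and q_(2k+1) = k mod 2.
    So d_(2k) and d_(2k+1) always differ ([dprime_even_neq]), whereas d_(2k-1)
    and d_(2k) agree exactly when d_k = 0 ([dprime_odd_eq]).  Reading d in the
    pairs of positions (2k-1, 2k), each pair is therefore a union of runs: one
    run of length 2 if d_k = 0, two runs of length 1 if d_k = 1.  Hence b is the
    image of d itself under the substitution 1 -> 11, 0 -> 2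
    ([run_length_image]).

    This substitution is injective on letters, so it carries the n-th run of d,
    of length b_n, to the n-th run of b ([nth_run_subst]).  The latter is a
    block of 2 b_n ones or of b_n twos, and has sum 2 b_n either way: b is a
    Cloitre sequence ([cloitre_run_length]).

    Finally there is at most one Cloitre sequence ([cloitre_unique]): the values
    of the runs alternate between 1 and 2, so a_n fixes the length of the n-th
    run, and the first n runs reach beyond position n + 1. *)

(** * The paperfolding sequence along even and odd indices *)

Lemma size_pf_word k : size (pf_word k) = (2 ^ k).-1.
Proof.
elim: k => //= k IH; rewrite size_cat /= size_map size_rev IH expnS.
have := expn_gt0 2 k; lia.
Qed.

Section Paperfolding.

Variable p : nat -> int.
Hypothesis hp : paperfolding p.

Lemma paperfolding_fold k : p (2 ^ k) = 1%R.
Proof.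
have k0 := expn_gt0 2 k.
have /(is_prefixP 0%R)/(_ (2 ^ k).-1) := hp k.+1.
rewrite size_pf_word prednK // => ->; last by rewrite expnS; lia.
by rewrite /= nth_cat size_pf_word ltnn subnn.
Qed.

Lemma paperfolding_mirror k j :
  0 < j < 2 ^ k -> p (2 ^ k + j) = (- p (2 ^ k - j))%R.
Proof.
move=> hj; have k0 := expn_gt0 2 k.
have /(is_prefixP 0%R)/(_ (2 ^ k + j).-1) := hp k.+1.
have /(is_prefixP 0%R)/(_ (2 ^ k - j).-1) := hp k.
rewrite !size_pf_word expnS !prednK; try lia.
move=> -> => [->|]; try lia.
rewrite /= nth_cat size_pf_word ifF; last by lia.
have -> : (2 ^ k + j).-1 - (2 ^ k).-1 = j.-1.+1 by lia.
rewrite /= (nth_map 0%R) ?size_rev ?nth_rev ?size_pf_word; try lia.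
by congr (- nth _ _ _)%R; lia.
Qed.

(** Folding about the centre 2^k of the word P_(k+1) commutes with doubling all
    indices, so the identity propagates from one dyadic range to the next. *)
Lemma paperfolding_double n : 0 < n -> p n.*2 = p n.
Proof.
have main k : forall n, 0 < n < 2 ^ k -> p n.*2 = p n.
  elim: k => [|k IH] {}n hn; first by move: hn; rewrite expn0; lia.
  case: (ltngtP n (2 ^ k)) => [h|h|->]; first by apply: IH; lia.
    have hj : 0 < n - 2 ^ k < 2 ^ k by move: hn; rewrite expnS; lia.
    have -> : n.*2 = 2 ^ k.+1 + (n - 2 ^ k).*2 by rewrite expnS; lia.
    rewrite paperfolding_mirror; last by rewrite expnS; lia.
    have -> : 2 ^ k.+1 - (n - 2 ^ k).*2 = (2 ^ k - (n - 2 ^ k)).*2.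
      by rewrite expnS; lia.
    rewrite IH; last by lia.
    by rewrite -paperfolding_mirror // subnKC // ltnW.
  by rewrite -mul2n -expnS !paperfolding_fold.
by move=> n0; apply: (main n); rewrite n0 ltn_expl.
Qed.

(** The fold about 2^(k+1) negates the terms and takes the odd index 2n+1 to
    2n'+1 with n + n' = 2^(k+1) - 1, so that n and n' have opposite parities:
    the two sign changes agree. *)
Lemma paperfolding_odd n : p n.*2.+1 = ((-1) ^+ n)%R.
Proof.
have main k : forall n, n.*2.+1 < 2 ^ k.+1 -> p n.*2.+1 = ((-1) ^+ n)%R.
  elim: k => [|k IH] {}n hn.
    have -> : n = 0 by move: hn; rewrite expn1; lia.
    exact: (paperfolding_fold 0).
  case: (ltnP n.*2.+1 (2 ^ k.+1)) => h; first exact: IH.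
  have hj : 0 < n.*2.+1 - 2 ^ k.+1 < 2 ^ k.+1.
    by move: hn h; rewrite !expnS; lia.
  rewrite -(subnKC h) paperfolding_mirror //.
  have -> : 2 ^ k.+1 - (n.*2.+1 - 2 ^ k.+1) = (2 ^ k.+1 - n.+1).*2.+1.
    by move: hn h; rewrite !expnS; lia.
  rewrite IH; last by move: hj; lia.
  rewrite -signr_odd -[in RHS]signr_odd oddB; last by move: hn; rewrite expnS; lia.
  by rewrite oddX /=; case: odd.
apply: (main n); have := ltn_expl n (isT : 1 < 2); rewrite expnS; lia.
Qed.

(** * Consecutive terms of the difference sequence *)

Variable q : nat -> nat.
Hypothesis hq : forall n, 0 < n -> q n = 0 \/ q n = 1.
Hypothesis hpq : forall n, 0 < n -> p n = ((-1) ^+ q n)%R.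

Let q_inj m n : 0 < m -> (n = 0 \/ n = 1) ->
  ((-1) ^+ q m)%R = ((-1) ^+ n : int)%R -> q m = n.
Proof. by move=> m0; case: (hq m0) => -> [] ->. Qed.

Lemma exponent_double n : 0 < n -> q n.*2 = q n.
Proof.
move=> n0; apply: q_inj; [by rewrite double_gt0|exact: hq|].
by rewrite -!hpq ?double_gt0 // paperfolding_double.
Qed.

Lemma exponent_odd n : q n.*2.+1 = odd n.
Proof.
apply: q_inj => //; first by case: odd; [right|left].
by rewrite -hpq // paperfolding_odd signr_odd.
Qed.

(** At n = 1 this can fail: there [dprime] is 1 by convention, while q 0 is
    arbitrary. *)
Lemma dprimeE n : 1 < n -> dprime q n = (q n != q n.-1).
Proof.
case: n => [|[|n]] // _; rewrite /dprime /=.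
by case: (hq (isT : 0 < n.+2)) => ->; case: (hq (isT : 0 < n.+1)) => ->.
Qed.

Lemma dprime01 n : 0 < n -> dprime q n = 0 \/ dprime q n = 1.
Proof.
by case: n => [|[|n]] // _; [right|rewrite dprimeE //; case: eqP; [left|right]].
Qed.

(** The middle term q_(2n) is compared with its two neighbours of odd index,
    which are distinct. *)
Lemma dprime_even_neq n : 0 < n -> dprime q n.*2.+1 <> dprime q n.*2.
Proof.
case: n => // n _; rewrite !dprimeE //= exponent_odd exponent_odd /=.
by case: (hq (isT : 0 < n.+1.*2)) => ->; case: odd.
Qed.

(** Both differences are taken with the middle term q_(2n-1), so they agree iff
    its neighbours q_(2n-2) = q_(n-1) and q_(2n) = q_n do.  For n = 1 there is
    no left neighbour, but the convention d_1 = 1 makes the statement true. *)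
Lemma dprime_odd_eq n : 0 < n ->
  (dprime q n.*2 = dprime q n.*2.-1) <-> dprime q n = 0.
Proof.
case: n => [|[|n]] // _.
  rewrite [dprime q 1.*2]dprimeE //= (exponent_odd 0).
  by rewrite (exponent_double (isT : 0 < 1)) (exponent_odd 0).
rewrite !dprimeE // (exponent_double (isT : 0 < n.+2)) /= exponent_odd.
rewrite (exponent_double (isT : 0 < n.+1)) /=.
case: (hq (isT : 0 < n.+2)) => ->; case: (hq (isT : 0 < n.+1)) => ->;
  by case: odd.
Qed.

End Paperfolding.

(** * Runs of arbitrary sequences *)

Lemma nth_run_block T (s : nat -> T) n i l : nth_run s n i l -> block s i l.
Proof. by case. Qed.

Lemma nth_run_gt0 T (s : nat -> T) n i l : nth_run s n i l -> 0 < n <= i.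
Proof.
elim=> [//|{}n {}i {}l l' r IH _].
by have [l0 _ _] := nth_run_block r; lia.
Qed.

Lemma nth_run_exists T (s : nat -> T) :
  (forall i, 0 < i -> exists l, block s i l) ->
  forall n, 0 < n -> exists i l, nth_run s n i l.
Proof.
move=> ex [//|n _]; elim: n => [|n [i [l r]]].
  by have [l bl] := ex 1 isT; exists 1, l; apply: nth_run1.
have /andP[n0 ni] := nth_run_gt0 r.
have [|l' bl] := ex (i + l); first by lia.
by exists (i + l), l'; apply: nth_runS bl.
Qed.

(** Replacing each term s_i by a nonempty block of copies of h(s_i), which
    begins at position M i of the new sequence t, preserves runs and their
    numbering, because h keeps distinct terms distinct. *)
Lemma nth_run_subst (T U : Type) (s : nat -> T) (t : nat -> U) (h : T -> U)
    (M : nat -> nat) :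
  M 1 = 1 -> (forall i, 0 < i -> M i < M i.+1) ->
  (forall i m, 0 < i -> M i <= m < M i.+1 -> t m = h (s i)) ->
  (forall i j, 0 < i -> 0 < j -> h (s i) = h (s j) -> s i = s j) ->
  forall n i l, nth_run s n i l -> nth_run t n (M i) (M (i + l) - M i).
Proof.
move=> M1 MS tM hinj.
have Mmono i l : 0 < i -> M i + l <= M (i + l).
  move=> i0; elim: l => [|l IH]; first by rewrite !addn0.
  by rewrite !addnS; apply: leq_ltn_trans IH (MS _ _); lia.
have bl i l : 0 < i -> block s i l -> block t (M i) (M (i + l) - M i).
  move=> i0 [l0 sE sN].
  have lM := Mmono i l i0.
  have ti j : 0 < j -> t (M j) = h (s j).
    by move=> j0; apply: tM => //; rewrite leqnn MS.
  split=> [|m|]; first by lia.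
    rewrite subnKC; last by lia.
    rewrite ti //; clear -i0 l0 sE tM MS; case: l l0 sE => // l _.
    elim: l => [|l IH] sE /andP[h1 h2].
      by apply: tM => //; rewrite h1 -[i.+1]addn1.
    case: (ltnP m (M (i + l.+1))) => h3.
      by apply: IH; rewrite ?h1 // => j hj; apply: sE; lia.
    rewrite (tM (i + l.+1)) ?sE //; try lia.
    by rewrite h3 -[X in m < M X]addnS.
  rewrite subnKC; last by lia.
  have il0 : 0 < i + l by lia.
  rewrite !ti //.
  by move=> E; apply: sN; apply: hinj E => //; lia.
move=> n i l; elim=> {n i l} [l b|n i l l' r IH b].
  by have := bl 1 l isT b; rewrite M1; apply: nth_run1.
have /andP[n0 ni] := nth_run_gt0 r.
have lM := Mmono i l (leq_trans n0 ni).
have -> : M (i + l) = M i + (M (i + l) - M i) by lia.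
apply: nth_runS IH _.
have -> : M i + (M (i + l) - M i) = M (i + l) by lia.
by apply: bl => //; lia.
Qed.

(** * Uniqueness of Cloitre's sequence *)

(** The values of successive runs alternate, since there are only two letters,
    and the first is 1; the sum of a run is its length times its value. *)
Lemma cloitre_run a n i l : cloitre a -> nth_run a n i l ->
  a i = (~~ odd n).+1 /\ l * (~~ odd n).+1 = 2 * a n.
Proof.
move=> [a12 a1 arun] r.
have ai : a i = (~~ odd n).+1.
  elim: r => [//|{}n {}i {}l l' r IH _].
  have [l0 _] := nth_run_block r; rewrite IH => N.
  have h : 0 < i + l by lia.
  by case: (a12 _ h) N => -> /=; case: odd.
split=> //; have /andP[n0 _] := nth_run_gt0 r.
have [i' [l' [r' <-]]] := arun n n0; have [<- <-] := nth_run_inj r r'.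
rewrite (eq_big_nat _ _ (F2 := fun=> (~~ odd n).+1)).
  by rewrite sum_nat_const_nat addKn.
by have [_ sE _] := nth_run_block r => j /sE ->.
Qed.

(** The strict inequality is what lets the first n runs determine the term of
    index n + 1; it comes from the first run, of length 2 a_1 = 2. *)
Lemma cloitre_run_end a n i l : cloitre a -> nth_run a n i l -> n.+1 < i + l.
Proof.
move=> ca; elim=> [l' b|{}n {}i {}l l' r IH [l0' _ _]]; last by lia.
have [_] := cloitre_run ca (nth_run1 b); have [_ -> _] := ca; lia.
Qed.

Lemma nth_run_pred T (s : nat -> T) n i l : nth_run s n.+1 i l ->
  (n = 0 /\ i = 1) \/ exists i' l', nth_run s n i' l' /\ i = i' + l'.
Proof.
move=> r; inversion r; first by left.
by right; eexists; eexists; split; first by eassumption.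
Qed.

Lemma cloitre_run_eq a b n i l : cloitre a -> cloitre b -> nth_run a n i l ->
  (forall m, 0 < m <= n -> a m = b m) ->
  nth_run b n i l /\ forall j, 0 < j < i + l -> a j = b j.
Proof.
move=> ca cb.
(* The k-th runs of a and b coincide once they start together and a k = b k. *)
have step k x y : nth_run a k x y -> a k = b k ->
    (forall x' y', nth_run b k x' y' -> x' = x) ->
    nth_run b k x y /\ forall j, x <= j < x + y -> a j = b j.
  move=> r ab start; have /andP[k0 _] := nth_run_gt0 r.
  have [_ _ /(_ k k0) [x' [y' [r' _]]]] := cb.
  have E := start _ _ r'; subst x'.
  have [ax ay] := cloitre_run ca r; have [bx by'] := cloitre_run cb r'.
  have E : y' = y by apply/eqP; rewrite -(@eqn_pmul2r (~~ odd k).+1) // by' ay ab.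
  subst y'; split=> // j hj.
  have [_ aE _] := nth_run_block r; have [_ bE _] := nth_run_block r'.
  by rewrite aE // bE // ax bx.
elim=> {n i l} [l bl|n i l l' r IH bl] ab.
  apply: step (nth_run1 bl) (ab 1 isT) _ => x' y'.
  by case/nth_run_pred=> [[]|[u [v [/nth_run_gt0]]]].
have [|rb rE] := IH; first by move=> m hm; apply: ab; lia.
have [||rb' rE'] := step _ _ _ (nth_runS r bl).
- by apply: ab; rewrite leqnn.
- move=> x' y' /nth_run_pred[[n0 _]|[u [v [r' ->]]]].
    by have := nth_run_gt0 r; rewrite n0.
  by have [-> ->] := nth_run_inj r' rb.
split=> // j hj; case: (ltnP j (i + l)) => h; [apply: rE|apply: rE']; lia.
Qed.

Lemma cloitre_unique a b : cloitre a -> cloitre b ->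
  forall n, 0 < n -> a n = b n.
Proof.
move=> ca cb n n0.
suff /(_ n n) : forall n m, 0 < m <= n -> a m = b m by apply; rewrite n0 leqnn.
elim=> [m|[|n'] IH m hm]; first by lia.
  have -> : m = 1 by lia.
  by case: ca cb => _ -> _ [_ -> _].
have [_ _ /(_ n'.+1 isT) [i [l [r _]]]] := ca.
have [_ ab] := cloitre_run_eq ca cb r IH.
by apply: ab; have := cloitre_run_end ca r; lia.
Qed.

(** * A sequence whose run lengths are its own image *)

Section SelfRuns.

Variable D : nat -> nat.
Hypothesis D01 : forall n, 0 < n -> D n = 0 \/ D n = 1.
Hypothesis D1 : D 1 = 1.
Hypothesis D_even_neq : forall n, 0 < n -> D n.*2.+1 <> D n.*2.
Hypothesis D_odd_eq : forall n, 0 < n -> (D n.*2 = D n.*2.-1) <-> D n = 0.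

(** The position in the run-length sequence where the image of D_i begins: a
    letter x in {0, 1} has an image of length x + 1. *)
Definition image_pos i := (\sum_(1 <= j < i) (D j).+1).+1.

Lemma image_posS i : 0 < i -> image_pos i.+1 = image_pos i + (D i).+1.
Proof. by move=> i0; rewrite /image_pos big_nat_recr. Qed.

Lemma image_pos1 : image_pos 1 = 1.
Proof. by rewrite /image_pos big_geq. Qed.

Lemma image_pos_cover n : 0 < n ->
  exists i, 0 < i /\ image_pos i <= n < image_pos i.+1.
Proof.
move=> n0.
suff main k : n < image_pos k.+1 ->
    exists i, 0 < i /\ image_pos i <= n < image_pos i.+1.
  apply: (main n); elim: (n) => [|k IH]; first by rewrite image_pos1.
  by rewrite image_posS //; lia.
elim: k => [|k IH] nk; first by move: nk; rewrite image_pos1; lia.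
case: (ltnP n (image_pos k.+1)) => [/IH //|kn].
by exists k.+1; rewrite kn nk.
Qed.

Lemma block_odd n : 0 < n -> block D n.*2.-1 (2 - D n).
Proof.
case: n => // n _; have [E1 E2] := D_odd_eq (isT : 0 < n.+1).
case: (D01 (isT : 0 < n.+1)) => Dn; rewrite Dn; split=> //=.
- move=> j hj; have [->//|->] : j = n.*2.+1 \/ j = n.+1.*2 by lia.
  exact: E2.
- rewrite addn2 => E; apply: (@D_even_neq n.+1) => //.
  by rewrite [RHS]E2.
- by move=> j hj; congr D; lia.
- by rewrite addn1 => /E1; rewrite Dn.
Qed.

Lemma block_even n : 0 < n -> block D n.*2 1.
Proof.
move=> n0; split=> // [j hj|]; first by congr D; lia.
by rewrite addn1; apply: D_even_neq.
Qed.

Lemma block_exists i : 0 < i -> exists l, block D i l.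
Proof.
move=> i0; have [[n n0 ->]|[n n0 ->]] : (exists2 n, 0 < n & i = n.*2.-1) \/
                                       (exists2 n, 0 < n & i = n.*2).
- by case: (boolP (odd i)) => oi; [left; exists i.+1./2|right; exists i./2]; lia.
- by exists (2 - D n); apply: block_odd.
- by exists 1; apply: block_even.
Qed.

(** The positions 2n-1 and 2n form one run if D n = 0 and two if D n = 1;
    either way they account for a number of runs equal to the length of the
    image of D n, which keeps the numbering in step with [image_pos]. *)
Lemma nth_run_image n : 0 < n ->
  nth_run D (image_pos n) n.*2.-1 (2 - D n) /\
  (D n = 1 -> nth_run D (image_pos n).+1 n.*2 1).
Proof.
case: n => // n _; have step k : 0 < k -> nth_run D (image_pos k) k.*2.-1 (2 - D k) ->
    D k = 1 -> nth_run D (image_pos k).+1 k.*2 1.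
  move=> k0 r Dk; rewrite Dk in r.
  have -> : k.*2 = k.*2.-1 + 1 by lia.
  by apply: nth_runS r _; rewrite addn1 prednK ?double_gt0 //; apply: block_even.
elim: n => [|n [IH1 IH2]].
  have r : nth_run D (image_pos 1) 1.*2.-1 (2 - D 1).
    by rewrite image_pos1; apply: nth_run1; apply: (@block_odd 1).
  by split=> //; apply: step.
suff r : nth_run D (image_pos n.+2) n.+2.*2.-1 (2 - D n.+2).
  by split=> //; apply: step.
rewrite image_posS //.
have bl := @block_odd n.+2 isT.
case: (D01 (isT : 0 < n.+1)) => Dn; rewrite Dn.
  have E : n.+2.*2.-1 = n.+1.*2.-1 + (2 - D n.+1) by rewrite Dn; lia.
  by rewrite addn1 E; apply: nth_runS IH1 _; rewrite -E.
have E : n.+2.*2.-1 = n.+1.*2 + 1 by lia.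
by rewrite addn2 E; apply: nth_runS (IH2 Dn) _; rewrite -E.
Qed.

(** The substitution is 1 -> 11, 0 -> 2: the letter 2 - x, repeated x + 1
    times. *)
Lemma run_length_image i m : 0 < i -> image_pos i <= m < image_pos i.+1 ->
  run_length D m = 2 - D i.
Proof.
move=> i0; rewrite image_posS // => hm; have [r r'] := nth_run_image i0.
case: (ltngtP m (image_pos i)) hm => [h|h|->] hm; try lia.
  case: (D01 i0) => Di; first by lia.
  have -> : m = (image_pos i).+1 by lia.
  by rewrite (run_lengthE (r' Di)) Di.
exact: run_lengthE r.
Qed.

(** The image of a run of l letters x has l (x + 1) letters 2 - x, and
    (x + 1) (2 - x) = 2 for both values of x. *)
Lemma cloitre_run_length : cloitre (run_length D).
Proof.
split=> [n n0||n n0].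
- have [i [i0 hi]] := image_pos_cover n0; rewrite (run_length_image i0 hi).
  by case: (D01 i0) => ->; [right|left].
- by rewrite (@run_length_image 1) ?D1 //; rewrite (@image_posS 1) // image_pos1.
have [i [l r]] := nth_run_exists block_exists n0.
have i0 : 0 < i by have := nth_run_gt0 r; lia.
have posS k : 0 < k -> image_pos k < image_pos k.+1.
  by move=> k0; rewrite image_posS //; lia.
have hinj j k : 0 < j -> 0 < k -> 2 - D j = 2 - D k -> D j = D k.
  by move=> j0 k0; case: (D01 j0) => ->; case: (D01 k0) => ->.
have r' := nth_run_subst (h := fun x => 2 - x) image_pos1 posS run_length_image hinj r.
exists (image_pos i), (image_pos (i + l) - image_pos i); split=> //.
have [_ bE _] := nth_run_block r'; have [_ sE _] := nth_run_block r.
rewrite (eq_big_nat _ _ (F2 := fun=> 2 - D i)); last first.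
  by move=> j /bE ->; rewrite (run_length_image i0) // leqnn posS.
rewrite sum_nat_const_nat addKn (run_lengthE r).
have -> : image_pos (i + l) = image_pos i + l * (D i).+1.
  elim: l sE {r r' bE} => [|l IH] sE; first by rewrite mul0n !addn0.
  rewrite addnS image_posS; last by lia.
  rewrite IH => [|j hj]; last by apply: sE; lia.
  by rewrite sE ?mulSnr ?addnA //; lia.
rewrite addKn; case: (D01 i0) => ->; lia.
Qed.

End SelfRuns.

Theorem mainTheorem2 (p : nat -> int) (q a : nat -> nat)
    (hp : paperfolding p)
    (hq : forall n, (0 < n)%N -> q n = 0%N \/ q n = 1%N)
    (hpq : forall n, (0 < n)%N -> p n = ((-1) ^+ q n)%R)
    (ha : cloitre a) :
  forall n, (0 < n)%N -> a n = run_length (dprime q) n.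
Proof.
apply: (cloitre_unique ha); apply: cloitre_run_length.
- exact: dprime01 hq.
- by [].
- by move=> n; apply: (dprime_even_neq hp hq hpq).
- by move=> n; apply: (dprime_odd_eq hp hq hpq).
Qed.
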